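(* Let $\mathcal{H}$ and $\mathcal{K}$ be separable Hilbert spaces. For every unitary operator $T\in B(\mathcal{H})$ and every $\Lambda_1\in B(\mathcal{H},\mathcal{K})$, the sequence $\Lambda=\{\Lambda_1T^{i-1}\in B(\mathcal{H},\mathcal{K}): i\in\mathbb{N}\}$ cannot be a $g$-frame for $\mathcal{H}$ with respect to $\mathcal{K}$.
   Context: $\mathbb{N}=\{1,2,3,\dots\}$; $B(\mathcal{H},\mathcal{K})$ denotes the bounded linear operators from $\mathcal{H}$ to $\mathcal{K}$, and $B(\mathcal{H})=B(\mathcal{H},\mathcal{H})$. A family $\Lambda=\{\Lambda_i\in B(\mathcal{H},\mathcal{K}): i\in\mathbb{N}\}$ is a $g$-frame for $\mathcal{H}$ with respect to $\mathcal{K}$ if there are constants $0<A_\Lambda\le B_\Lambda<\infty$ such that $A_\Lambda\|f\|^2\le\sum_{i\in\mathbb{N}}\|\Lambda_i f\|^2\le B_\Lambda\|f\|^2$ for all $f\in\mathcal{H}$.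
   Formalization: The Hilbert space H is assumed to be nonzero: for H = {0} every such sequence is trivially a g-frame (all sums and norms are 0), so the claim fails there. *)

(* Defs.v *)
From HB Require Import structures.
From mathcomp Require Import all_boot all_order all_algebra.
From mathcomp Require Import complex.
From mathcomp Require Import all_classical all_reals all_analysis.

Set Implicit Arguments.
Unset Strict Implicit.
Unset Printing Implicit Defensive.

Import Order.TTheory GRing.Theory Num.Theory.
Import numFieldNormedType.Exports.

Local Open Scope classical_set_scope.
Local Open Scope ring_scope.

(* Hilbert spaces may be real or complex; both cases are covered. Over R[i],
   [0 < a] and [a <= b] compare real parts and force equal imaginary parts, so
   a positive scalar is a positive real, and norms take values in the
   nonnegative reals. *)
Variant scalar_kind := RealScalars | ComplexScalars.

Definition scalar_field (R : realType) (s : scalar_kind) : numFieldType :=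
  match s with
  | RealScalars => R
  | ComplexScalars => R[i]
  end.

Definition scalar_conj (R : realType) (s : scalar_kind) :
    scalar_field R s -> scalar_field R s :=
  match s with
  | RealScalars => idfun
  | ComplexScalars => @Num.conj R[i]
  end.
Arguments scalar_conj : clear implicits.

HB.mixin Record NormedModule_hasInner (F : numFieldType) (theta : F -> F)
    (H : Type) of NormedModule F H := {
  inner : {dot H for theta};
  sqr_norm_inner : forall x : H, `|x| ^+ 2 = inner x x
}.

#[short(type="hilbertOverType")]
HB.structure Definition Hilbert (F : numFieldType) (theta : F -> F) :=
  {H of CompleteNormedModule F H & NormedModule_hasInner F theta H}.

Notation hilbertType R s := (@hilbertOverType (scalar_field R s) (scalar_conj R s)).

Definition separable (T : topologicalType) : Prop :=
  exists D : set T, countable D /\ dense D.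

Section Operators.
Variables (R : realType) (s : scalar_kind).

Definition bounded_operator (H K : hilbertType R s) : set (H -> K) :=
  [set f | linear f /\ exists M : scalar_field R s, forall x, `|f x| <= M * `|x|].

Definition adjoint (H K : hilbertType R s) (T : H -> K) (S : K -> H) : Prop :=
  forall x y, inner (T x) y = inner x (S y).

Definition unitary (H : hilbertType R s) (T : H -> H) : Prop :=
  bounded_operator T /\
  exists S : H -> H,
    [/\ bounded_operator S, adjoint T S, S \o T = idfun & T \o S = idfun].

(* Families are indexed by {1, 2, 3, ...}: the value at 0 is ignored. The series
   of squared norms has nonnegative terms, so "at most B |f|^2" includes its
   convergence. *)
Definition g_frame (H K : hilbertType R s) (Lam : nat -> H -> K) : Prop :=
  (forall i, (1 <= i)%N -> bounded_operator (Lam i)) /\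
  exists A B : scalar_field R s, [/\ 0 < A, A <= B &
    forall f : H,
      let u (n : nat) : scalar_field R s := \sum_(1 <= i < n) `|Lam i f| ^+ 2 in
      cvgn u /\ A * `|f| ^+ 2 <= limn u <= B * `|f| ^+ 2].

End Operators.

(* Main.v *)
(* Fix f <> 0. Since T is an isometry, the lower frame bound applied to T^k f
   bounds the k-th tail of the convergent series of the |Lam_i f|^2 below by
   A |f|^2 > 0, for every k; but the tails tend to 0. *)
Require Import Defs.
From HB Require Import structures.
From mathcomp Require Import all_boot all_order all_algebra.
From mathcomp Require Import all_classical all_reals all_analysis.

Set Implicit Arguments.
Unset Strict Implicit.
Unset Printing Implicit Defensive.

Import Order.TTheory GRing.Theory Num.Theory.
Import numFieldNormedType.Exports.

Local Open Scope classical_set_scope.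
Local Open Scope ring_scope.

(** The adjoint of [T] is also its left inverse, so moving [T] across gives [inner (T x) (T x) =
    inner x (S (T x)) = inner x x]. *)
Lemma unitary_norm (R : realType) (s : scalar_kind) (H : hilbertType R s)
    (T : H -> H) : unitary T -> forall x, `|T x| = `|x|.
Proof.
move=> [_ [S [_ adjTS ST _]]] x; apply/eqP.
rewrite -(@eqrXn2 _ 2%N) ?normr_ge0// !sqr_norm_inner adjTS.
by have /= -> := congr1 (fun g => g x) ST.
Qed.

Lemma iter_norm (F : numDomainType) (V : normedZmodType F) (T : V -> V) n x :
  (forall y, `|T y| = `|y|) -> `|iter n T x| = `|x|.
Proof. by move=> normT; elim: n => //= n IHn; rewrite normT. Qed.

Lemma iter_linear (F : pzRingType) (V : lmodType F) (T : V -> V) n :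
  linear T -> linear (iter n T).
Proof. by move=> linT a u v; elim: n => //= n ->; rewrite linT. Qed.

Lemma shifted_series_lim (F : numFieldType) (w : nat -> F) (k : nat) :
  let u n := \sum_(1 <= i < n) w i in
  let v n := \sum_(1 <= i < n) w (i + k)%N in
  cvgn u -> limn v = limn u - u k.+1.
Proof.
move=> u v cu; apply: (cvg_lim (@norm_hausdorff _ _)).
(* Dropping index 0 matters: for [k >= 1], [v 0 = 0] while [u k - u k.+1] is [- w k]; the identity
   below starts at [v 1]. *)
rewrite -(cvg_shiftS v).
have -> : [sequence v n.+1]_n = (fun n => u (n + k.+1)%N - u k.+1).
  apply/funext => n /=.
  rewrite /u (big_cat_nat (n := k.+1)) ?leq_addl//= addrAC subrr add0r.
  by rewrite -(add1n k) big_addn addnA addnK addn1.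
by apply: cvgB; [rewrite (cvg_shiftn k.+1 u) | exact: cvg_cst].
Qed.

Lemma cvg_dist_gt0 (F : numFieldType) (u : nat -> F) (e : F) :
  cvgn u -> 0 < e -> exists k, `|limn u - u k.+1| < e.
Proof.
move=> /cvgrPdist_lt cu /cu [N _ /(_ N.+1)] /= h; exists N; exact: h.
Qed.

Theorem corollary2p5 (R : realType) (s : scalar_kind) (H K : hilbertType R s)
    (sepH : separable H) (sepK : separable K) (H_neq0 : exists x : H, x != 0)
    (T : H -> H) (unitaryT : unitary T)
    (Lam1 : H -> K) (bddLam1 : bounded_operator Lam1) :
  let Lam (i : nat) : H -> K := Lam1 \o iter i.-1 T in
  (forall i : nat, (1 <= i)%N -> bounded_operator (Lam i)) /\ ~ g_frame Lam.
Proof.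
move=> Lam; have normT := unitary_norm unitaryT.
have normTn n x : `|iter n T x| = `|x| by exact: iter_norm.
split.
  move=> i _; have [[linT _] _] := unitaryT.
  have [linL [M LM]] := bddLam1; split.
    by move=> a u v; rewrite /Lam /= iter_linear// linL.
  (* The bound [M] of [Lam1] serves every [Lam i], as iterates of [T] preserve norms. *)
  by exists M => x; rewrite /Lam /= (le_trans (LM _))// normTn.
(* On the zero space every family of bounded operators is a g-frame, whence the nonzero [f]. *)
move=> [_ [A [B [A0 _ frame]]]]; have [f f0] := H_neq0.
have e0 : 0 < A * `|f| ^+ 2 by rewrite mulr_gt0// exprn_gt0// normr_gt0.
have [/= cu _] := frame f.
have [k] := cvg_dist_gt0 cu e0.
have [_ /andP[+ _]] := frame (iter k T f).
rewrite normTn.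
pose w i := `|Lam i f| ^+ 2.
(* For [i >= 1], [i.-1 + k = (i + k).-1]: evaluating at the [k]-th iterate of [f] shifts the family
   by [k]. *)
have -> : (fun n => \sum_(1 <= i < n) `|Lam i (iter k T f)| ^+ 2) =
          (fun n => \sum_(1 <= i < n) w (i + k)%N).
  apply/funext => n; apply: eq_big_nat => -[//|i] _.
  by rewrite /w /Lam /= -iterD.
rewrite (shifted_series_lim (w := w))// => le_tail.
(* The tail is at least [A * |f|^2 > 0], so its absolute value is itself, against the choice of
   [k]. *)
by rewrite ger0_norm ?(le_trans (ltW e0))// => /(le_lt_trans le_tail); rewrite ltxx.
Qed.
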